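(* There exists a function $f:\mathbb{N}\times\mathbb{N}\to\mathbb{N}$ such that for every finite field $\mathbb{F}$, every $d\in\mathbb{N}$, and every $\mathbb{F}$-representable matroid $M$ with $\mathrm{dd}(M)=d$ and $\mathrm{dd}(M/S)<d$ for every non-empty set $S$ of elements of $M$, we have $|M|\le f(|\mathbb{F}|,d)$.
   Context: $|M|$ is the number of elements of $M$; $M/S$ denotes the usual matroid contraction and $M\setminus e$ deletion. A matroid is connected if any two elements lie in a common circuit; components are maximal connected restrictions. The deletion-depth is defined recursively: if $M$ has a single element, $\mathrm{dd}(M)=1$; if $M$ is not connected, $\mathrm{dd}(M)$ is the maximum deletion-depth of a component of $M$; if $M$ is connected, $\mathrm{dd}(M)=1+\min_{e\in M}\mathrm{dd}(M\setminus e)$. *)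

(* Defs.v *)
From HB Require Import structures.
From mathcomp Require Import all_boot all_order all_algebra.
Set Implicit Arguments. Unset Strict Implicit. Unset Printing Implicit Defensive.
Import GRing.Theory.

Record matroid (E : finType) := Matroid {
  ground : {set E};
  rk : {set E} -> nat;
  rk_card : forall A : {set E}, A \subset ground -> rk A <= #|A|;
  rk_mono : forall A B : {set E}, A \subset B -> B \subset ground -> rk A <= rk B;
  rk_submod : forall A B : {set E}, A \subset ground -> B \subset ground ->
     rk (A :|: B) + rk (A :&: B) <= rk A + rk B
}.

Section MatroidDefs.
Variable E : finType.
Implicit Types (r : {set E} -> nat) (X C S : {set E}).

Definition is_circuit r X C : bool :=
  [&& C \subset X, r C < #|C| &
      [forall D : {set E}, (D \proper C) ==> (r D == #|D|)]].

Definition conn r X (e f : E) : bool :=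
  (e == f) || [exists C : {set E}, [&& is_circuit r X C, e \in C & f \in C]].

Definition connectedb r X : bool :=
  [forall e in X, forall f in X, conn r X e f].

Definition components r X : {set {set E}} :=
  [set [set f in X | conn r X e f] | e in X].

(* deletion-depth of the matroid with rank r and ground set X, with fuel k.
   Deletion and restriction do not change the rank function.
   The minimum over e is taken with default #|X|, which exceeds every
   deletion-depth of M\e (dd <= number of elements). *)
Fixpoint ddf r (k : nat) X : nat :=
  match k with
  | 0 => 0
  | k'.+1 =>
    if #|X| <= 1 then #|X|
    else if connectedb r X then
      (\big[minn/#|X|]_(e in X) ddf r k' (X :\ e)).+1
    else \max_(C in components r X) ddf r k' C
  end.

Definition dd_of r X : nat := ddf r #|X| X.

Definition contract_rk r S : {set E} -> nat := fun A => r (A :|: S) - r S.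

End MatroidDefs.

Definition dd (E : finType) (M : matroid E) : nat := dd_of (rk M) (ground M).

Definition dd_contract (E : finType) (M : matroid E) (S : {set E}) : nat :=
  dd_of (contract_rk (rk M) S) (ground M :\: S).

Definition represents (F : fieldType) (E : finType) (n : nat)
   (v : E -> 'rV[F]_n) (M : matroid E) : Prop :=
  forall A : {set E}, A \subset ground M ->
    rk M A = \rank (\sum_(e in A) <<v e>>)%MS.

Definition representable (F : fieldType) (E : finType) (M : matroid E) : Prop :=
  exists n (v : E -> 'rV[F]_n), represents v M.

(* Main.v *)
Require Import Defs.
From mathcomp Require Import all_boot all_order all_algebra all_field.
From Stdlib Require Import ClassicalEpsilon.
Set Implicit Arguments. Unset Strict Implicit. Unset Printing Implicit Defensive.
Import GRing.Theory.

(* The words of the code C = {c : sum_x c_x v_x = 0} supported in X describe the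
   restriction of M to X, and puncturing C at S describes M/S. Call M <= M'
   when M is isomorphic to some M'/S. The F-matroids of deletion-depth at
   most d, with elements labelled by a finite set, are well-quasi-ordered, by
   induction on d. If M is connected and deleting e lowers the depth, C is
   the sum of the code of M \ e and the line spanned by one word g with g e =
   1, so M is encoded by M \ e with each element x given the extra label g x
   in F. If M is disconnected, C is the direct sum of the codes of its
   components and Higman's lemma applies. If matroids as in the theorem were
   unboundedly large, two of distinct sizes would be comparable for <=,
   giving a nonempty S with dd(M'/S) = d. *)

(** * Well-quasi-orders and Higman's lemma *)

Definition wqo (T : Type) (P : T -> Prop) (le : T -> T -> Prop) : Prop :=
  forall s : nat -> T, (forall n, P (s n)) ->
  exists i j, i < j /\ le (s i) (s j).

Lemma iter_increasing (f : nat -> nat) :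
  (forall n, f n < f n.+1) -> forall i j, i < j -> f i < f j.
Proof.
move=> fS i; elim=> // j IHj; rewrite ltnS leq_eqVlt => /orP [/eqP -> //|].
by move=> /IHj /ltn_trans; apply.
Qed.

(** Terms below no later term occur only up to some index, since infinitely many of them would form
    a sequence with no good pair. Beyond that index one can jump to a larger later term forever, and
    transitivity does the rest. *)
Lemma wqo_subseq (T : Type) (P : T -> Prop) (le : T -> T -> Prop) (s : nat -> T) :
  (forall x y z, le x y -> le y z -> le x z) ->
  wqo P le -> (forall n, P (s n)) ->
  exists h : nat -> nat, (forall i j, i < j -> h i < h j) /\
    (forall i j, i < j -> le (s (h i)) (s (h j))).
Proof.
move=> le_trans wqP Ps.
have [N nxtP] : exists N, forall i, N <= i -> exists j, i < j /\ le (s i) (s j).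
  apply: NNPP => noN.
  have dead N : exists i, N <= i /\ forall j, i < j -> ~ le (s i) (s j).
    apply: NNPP => nodead; apply: noN; exists N => i leNi.
    apply: NNPP => noj; apply: nodead; exists i; split=> // j ltij leij.
    by apply: noj; exists j.
  pose t N := proj1_sig (constructive_indefinite_description _ (dead N)).
  have tP N : N <= t N /\ forall j, t N < j -> ~ le (s (t N)) (s j).
    exact: proj2_sig (constructive_indefinite_description _ (dead N)).
  (* [h] enumerates increasing indices of such dead terms; a good pair along [h] contradicts their
     choice. *)
  pose h n := iter n (fun m => t m.+1) (t 0).
  have hmono i j : i < j -> h i < h j.
    by apply: iter_increasing => n; have [] := tP (h n).+1.
  have [i [j [ltij leij]]] := wqP (s \o h) (fun n => Ps (h n)).
  have := hmono _ _ ltij.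
  case: i {ltij} leij => [|i] leij lth.
    by have [_ /(_ _ lth)] := tP 0.
  by have [_ /(_ _ lth)] := tP (h i).+1.
(* The guard [N <= i] sits under the existential so that the choice function is total; 0 is a dummy
   value. *)
have nxt' i : exists j, N <= i -> i < j /\ le (s i) (s j).
  by case: (leqP N i) => [/nxtP [j ?]|?]; [exists j | exists 0].
pose t i := proj1_sig (constructive_indefinite_description _ (nxt' i)).
have tP i : N <= i -> i < t i /\ le (s i) (s (t i)).
  exact: proj2_sig (constructive_indefinite_description _ (nxt' i)).
pose h n := iter n t N.
have hN n : N <= h n.
  by elim: n => //= n IHn; have [lt _] := tP _ IHn; apply: (leq_trans IHn (ltnW lt)).
exists h; split.
  by apply: iter_increasing => n; have [] := tP _ (hN n).
move=> i; elim=> // j IHj; rewrite ltnS leq_eqVlt => /orP [/eqP ->|].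
  by have [] := tP _ (hN j).
by move=> /IHj /le_trans; apply; have [] := tP _ (hN j).
Qed.

Lemma wqo_finite (K : finType) : wqo (fun _ : K => True) eq.
Proof.
move=> s _; apply: NNPP => nogood.
pose f (i : 'I_#|K|.+1) := s i.
have /leq_card : injective f.
  move=> i j eqf; apply/val_inj; apply: NNPP => neq.
  case: (ltngtP i j) => // lt; apply: nogood; first by exists i, j.
  by exists j, i.
by rewrite card_ord ltnn.
Qed.

(** Higman's subsequence order: each entry of [t] is skipped or matched with the next entry of [s].
    Two types are allowed so that sets over different carriers can be compared. *)
Fixpoint hemb (A B : Type) (R : A -> B -> Prop) (s : seq A) (t : seq B) : Prop :=
  if s is x :: s' then
    if t is y :: t' then hemb R s t' \/ (R x y /\ hemb R s' t') else False
  else True.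

Lemma hemb0 (A B : Type) (R : A -> B -> Prop) t : hemb R [::] t.
Proof. by case: t. Qed.

Lemma hemb_map (A B A' B' : Type) (R : A -> B -> Prop) (f : A' -> A) (g : B' -> B) s t :
  hemb R (map f s) (map g t) -> hemb (fun x y => R (f x) (g y)) s t.
Proof.
elim: t s => [|y t IHt] [|x s] //= [/(IHt (x :: s)) ?|[? /IHt ?]]; [by left | by right].
Qed.

Lemma ex_min_measure (T : Type) (P : T -> Prop) (m : T -> nat) :
  (exists x, P x) -> exists x, P x /\ forall y, P y -> m x <= m y.
Proof.
case=> x; have [n le_n] := ubnP (m x); elim: n x le_n => // n IHn x le_n Px.
case: (classic (exists y, P y /\ m y < m x)) => [[y [Py lt]]|no].
  by apply: IHn Py; apply: leq_trans lt le_n.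
exists x; split=> // y Py; rewrite leqNgt; apply/negP => lt.
by apply: no; exists y.
Qed.

Section Higman.
Variables (T : Type) (P : T -> Prop) (le : T -> T -> Prop).
Hypothesis le_trans : forall x y z, le x y -> le y z -> le x z.
Hypothesis wqP : wqo P le.

Let bad (f : nat -> seq T) : Prop :=
  (forall n, List.Forall P (f n)) /\ forall i j, i < j -> ~ hemb le (f i) (f j).

Let ext (p : seq (seq T)) : Prop :=
  exists f, bad f /\ forall i, i < size p -> f i = nth [::] p i.

(** Nash-Williams's construction: pick words one by one, each as short as possible among those that
    keep the prefix extendable to a bad sequence. *)
Lemma minimal_bad_sequence (f : nat -> seq T) : bad f ->
  exists w, bad w /\
    forall n g, bad g -> (forall i, i < n -> g i = w i) -> size (w n) <= size (g n).
Proof.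
move=> badf.
have stepP p : exists x, ext p ->
    ext (rcons p x) /\ forall y, ext (rcons p y) -> size x <= size y.
  case: (classic (ext p)) => [extp|]; last by exists [::].
  have [|x xP] := @ex_min_measure _ (fun x => ext (rcons p x)) size; last by exists x.
  case: extp => g [badg gp]; exists (g (size p)), g; split=> // i.
  rewrite size_rcons ltnS nth_rcons leq_eqVlt => /orP [/eqP ->|lti].
    by rewrite ltnn eqxx.
  by rewrite lti gp.
pose nx p := proj1_sig (constructive_indefinite_description _ (stepP p)).
have nxP p : ext p ->
    ext (rcons p (nx p)) /\ forall y, ext (rcons p y) -> size (nx p) <= size y.
  exact: proj2_sig (constructive_indefinite_description _ (stepP p)).
pose pref n := iter n (fun p => rcons p (nx p)) [::].
pose w n := nx (pref n).
have extpref n : ext (pref n).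
  by elim: n => [|n IHn] /=; [exists f | have [] := nxP _ IHn].
have prefE n : pref n = mkseq w n by elim: n => // n IHn; rewrite mkseqS -IHn.
exists w; split.
  (* Badness only involves pairs of indices, so agreement of every prefix with some bad sequence
     suffices. *)
  have agree j : exists g, bad g /\ forall i, i <= j -> g i = w i.
    have [g [badg gp]] := extpref j.+1; exists g; split=> // i leij.
    by rewrite gp prefE ?size_mkseq // nth_mkseq.
  split=> [n|i j ltij].
    by have [g [[Pg _] gw]] := agree n; rewrite -gw.
  by have [g [[_ badg] gw]] := agree j; rewrite -!gw //; [apply: badg | apply: ltnW].
move=> n g badg gw; have [_] := nxP _ (extpref n); apply.
exists g; split=> // i; rewrite prefE size_rcons size_mkseq ltnS nth_rcons size_mkseq.
rewrite leq_eqVlt => /orP [/eqP ->|lti]; first by rewrite ltnn eqxx.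
by rewrite lti nth_mkseq // gw.
Qed.

Lemma higman : wqo (List.Forall P) (hemb le).
Proof.
move=> f Pf; apply: NNPP => nogood.
have [|w [[Pw badw] minw]] := @minimal_bad_sequence f.
  by split=> // i j ltij hij; apply: nogood; exists i, j.
have w_neq n : w n <> [::] by move=> w0; apply: (badw n n.+1) => //; rewrite w0; apply: hemb0.
have [x0 _] : exists x : T, True.
  by case: (w 0) (w_neq 0) => [|x l _]; [case | exists x].
pose hd n := head x0 (w n); pose tl n := behead (w n).
have wE n : w n = hd n :: tl n by rewrite /hd /tl; case: (w n) (w_neq n) => [|//]; case.
have Phd n : P (hd n) by have := Pw n; rewrite wE => /List.Forall_cons_iff [].
have Ptl n : List.Forall P (tl n) by have := Pw n; rewrite wE => /List.Forall_cons_iff [].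
have [h [hmono hle]] := wqo_subseq le_trans wqP Phd.
have h0 n : h 0 <= h n by case: n => // n; apply/ltnW/hmono.
(* Along [h] the heads increase. Replacing [w] from [h 0] on by the tails along [h] keeps it bad but
   shortens entry [h 0], against minimality. *)
pose g i := if i < h 0 then w i else tl (h (i - h 0)).
have : size (w (h 0)) <= size (g (h 0)).
  apply: minw => [|i lti]; last by rewrite /g lti.
  split=> [n|i j ltij]; first by rewrite /g; case: ifP.
  rewrite /g; case: (ltnP j (h 0)) => [ltj|lej].
    by rewrite (ltn_trans ltij ltj); apply: badw.
  case: (ltnP i (h 0)) => [lti|lei] hij.
    apply: (badw i (h (j - h 0))); first exact: leq_trans lti (h0 _).
    by rewrite (wE (h _)) /=; case: (w i) hij => //= *; left.
  have lt' : i - h 0 < j - h 0 by rewrite ltn_sub2r // (leq_ltn_trans lei).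
  apply: (badw (h (i - h 0)) (h (j - h 0))); first exact: hmono.
  by rewrite (wE (h (i - h 0))) (wE (h (j - h 0))) /=; right; split=> //; apply: hle.
by rewrite /g ltnn subnn wE /= ltnn.
Qed.

End Higman.

Local Open Scope ring_scope.

(** * Linear codes and their matroids *)

Section Codes.
Variables (F : fieldType) (E : finType).
Implicit Types (C : pred {ffun E -> F}) (c d a b : {ffun E -> F}) (X Y D Z A : {set E}).

Definition supp c : {set E} := [set x | c x != 0].

Definition lin_code C : Prop :=
  [ffun => 0] \in C /\
  forall t c d, c \in C -> d \in C -> [ffun x => t * c x + d x] \in C.

(** States that [r] is, on X, the rank of the matroid whose linear dependencies are the words of C.
    The form by one-element extensions passes to subsets and suits induction. *)
Definition rank_on C (r : {set E} -> nat) X : Prop :=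
  r set0 = 0%N /\
  forall A x, x |: A \subset X -> x \notin A ->
    (r (x |: A) = r A \/ r (x |: A) = (r A).+1) /\
    (r (x |: A) = r A <-> exists c, [/\ c \in C, supp c \subset x |: A & c x != 0]).

Definition minimal_word C c : Prop :=
  [/\ c \in C, supp c != set0 &
      forall d, d \in C -> supp d \proper supp c -> supp d = set0].

Lemma suppP c X : reflect (forall x, x \notin X -> c x = 0) (supp c \subset X).
Proof.
apply: (iffP subsetP) => [sub x|z x].
  by apply: contraNeq => cx; apply: sub; rewrite inE.
by rewrite inE; apply: contraNT => /z ->.
Qed.

Lemma rank_on_sub C r X Y : Y \subset X -> rank_on C r X -> rank_on C r Y.
Proof.
by move=> sYX [r0 rS]; split=> // A x sA; apply: rS; apply: subset_trans sYX.
Qed.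

Lemma rank_on_le C r X A : rank_on C r X -> A \subset X -> (r A <= #|A|)%N.
Proof.
move=> [r0 rS]; have [n le_n] := ubnP #|A|; elim: n A le_n => // n IHn A le_n sAX.
have [->|/set0Pn [x xA]] := eqVneq A set0; first by rewrite r0.
have := rS (A :\ x) x; rewrite setD1K // setD11 => /(_ sAX isT) [rA _].
have := cardsD1 x A; rewrite xA => cA.
have /IHn : (#|A :\ x| < n)%N by rewrite cA in le_n.
rewrite (subset_trans _ sAX) ?subD1set // => /(_ isT) leA.
by rewrite cA add1n; case: rA => ->; rewrite ?ltnS // ltnW.
Qed.

(** Remove one x from A: either x adds no rank, which yields a word nonzero at x, or the deficit is
    already present in A minus x. *)
Lemma rank_on_dep C r X A : rank_on C r X -> A \subset X ->
  (r A < #|A|)%N <-> exists c, [/\ c \in C, supp c \subset A & supp c != set0].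
Proof.
move=> rX sAX; have [r0 rS] := rX; split.
  have [n le_n] := ubnP #|A|; elim: n A le_n sAX => // n IHn A le_n sAX.
  have [->|/set0Pn [x xA]] := eqVneq A set0; first by rewrite r0 cards0.
  have := rS (A :\ x) x; rewrite setD1K // setD11 => /(_ sAX isT) [rA crA].
  have := cardsD1 x A; rewrite xA => cA.
  case: rA => rA.
    have /crA [c [cC sc cx]] := rA.
    by move=> _; exists c; split=> //; apply/set0Pn; exists x; rewrite inE.
  rewrite cA rA add1n ltnS => lt.
  case: (IHn (A :\ x)) => // [||c [cC sc c0]].
  - by rewrite cA in le_n.
  - by rewrite (subset_trans _ sAX) ?subD1set.
  by exists c; split=> //; apply: subset_trans sc _; apply: subD1set.
move=> [c [cC sc /set0Pn [x]]]; rewrite inE => cx.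
have xA : x \in A by apply: (subsetP sc); rewrite inE.
have := rS (A :\ x) x; rewrite setD1K // setD11 => /(_ sAX isT) [_ [_ ->]].
  rewrite (cardsD1 x A) xA ltnS; apply: (rank_on_le rX).
  by rewrite (subset_trans _ sAX) ?subD1set.
by exists c.
Qed.

(** The dictionary between matroid and code: by [rank_on_dep], minimal dependent sets are the
    minimal nonempty supports. *)
Lemma is_circuitP C r X Y D : rank_on C r X -> Y \subset X ->
  is_circuit r Y D <-> exists c, [/\ minimal_word C c, supp c = D & D \subset Y].
Proof.
move=> rX sYX; split.
  case/and3P=> sDY rD /forallP minD.
  have sDX := subset_trans sDY sYX.
  have /(rank_on_dep rX sDX) [c [cC sc c0]] := rD.
  have minD' d : d \in C -> supp d \proper D -> supp d = set0.
    move=> dC pd; apply/eqP; apply: contraT => d0.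
    have /implyP/(_ pd)/eqP rd := minD (supp d).
    have sdX := subset_trans (proper_sub pd) sDX.
    suff : (r (supp d) < #|supp d|)%N by rewrite rd ltnn.
    by apply/(rank_on_dep rX sdX); exists d.
  have scD : supp c = D.
    apply/eqP; rewrite eqEproper sc; apply/negP => /(minD' _ cC) /eqP.
    by rewrite (negPf c0).
  by exists c; split=> //; split=> // d; rewrite scD; apply: minD'.
case=> c [[cC c0 minc] <-{D} sDY]; have sDX := subset_trans sDY sYX.
apply/and3P; split=> //; first by apply/(rank_on_dep rX sDX); exists c.
apply/forallP => D; apply/implyP => pD.
have sD'X := subset_trans (proper_sub pD) sDX.
rewrite eqn_leq (rank_on_le rX) //= leqNgt; apply/negP.
move=> /(rank_on_dep rX sD'X) [d [dC sd /eqP d0]]; apply: d0.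
by apply: minc => //; apply: sub_proper_trans pD.
Qed.

Lemma lin_code_subZ C t c d : lin_code C -> c \in C -> d \in C ->
  [ffun x => c x - t * d x] \in C.
Proof.
move=> [_ linC] cC dC; have := linC (- t) d c dC cC.
by congr (_ \in C); apply/ffunP => x; rewrite !ffunE mulNr addrC.
Qed.

(** Circuit elimination for words; the last clause is used to keep a chosen coordinate nonzero. *)
Lemma eliminate c d y (c' := [ffun x => c x - c y / d y * d x] : {ffun E -> F}) :
  d y != 0 -> [/\ c' y = 0, supp c' \subset (supp c :|: supp d) :\ y &
    forall x, d x = 0 -> c' x = c x].
Proof.
move=> dy; have c'y : c' y = 0 by rewrite ffunE divfK // subrr.
split=> // [|x dx]; last by rewrite ffunE dx mulr0 subr0.
apply/subsetP => x; rewrite !inE; have [->|_ /=] := eqVneq x y; first by rewrite c'y eqxx.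
rewrite ffunE; apply: contraR; rewrite negb_or !negbK => /andP [/eqP -> /eqP ->].
by rewrite mulr0 subr0.
Qed.

(** Induction on the support: if a nonzero word d has smaller support, either d is nonzero at e and
    replaces c, or d removes an element from c without touching its value at e. *)
Lemma minimal_word_through C c e : lin_code C -> c \in C -> c e != 0 ->
  exists d, [/\ minimal_word C d, supp d \subset supp c & d e != 0].
Proof.
move=> linC; have [n le_n] := ubnP #|supp c|; elim: n c le_n => // n IHn c le_n cC ce.
case: (classic (minimal_word C c)) => [|notmin]; first by exists c.
have c0 : supp c != set0 by apply/set0Pn; exists e; rewrite inE.
have [d [dC pd d0]] : exists d, [/\ d \in C, supp d \proper supp c & supp d != set0].
  apply: NNPP => no; apply: notmin; split=> // d dC pd.
  by apply/eqP; apply: contraT => d0; case: no; exists d.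
have IH c' : c' \in C -> supp c' \proper supp c -> c' e != 0 ->
    exists d, [/\ minimal_word C d, supp d \subset supp c & d e != 0].
  move=> c'C pc' c'e; have [|b [bmin sb be]] := IHn c' _ c'C c'e.
    by apply: leq_trans (proper_card pc') _.
  by exists b; split=> //; apply: subset_trans sb (proper_sub pc').
have [de0|de] := eqVneq (d e) 0; last exact: IH pd de.
have /set0Pn [y] := d0; rewrite inE => dy.
have [c'y sc' c'E] := eliminate c dy.
apply: (IH _ (lin_code_subZ (c y / d y) linC cC dC)); last by rewrite c'E.
apply: sub_proper_trans sc' _; rewrite (setUidPl (proper_sub pd)) properD1 //.
by apply: (subsetP (proper_sub pd)); rewrite inE.
Qed.

(** * Connectivity through minimal words *)

Definition linked C X e f : Prop :=
  exists c, [/\ minimal_word C c, supp c \subset X, c e != 0 & c f != 0].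

(* Shrink the union of two intersecting minimal supports, one through e and the
   other through g, by eliminating a common element. *)
Lemma linked_trans C X e f g : lin_code C ->
  linked C X e f -> linked C X f g -> linked C X e g.
Proof.
move=> linC [a [mina sa ae af]] [b [minb sb bf bg]].
have [n le_n] := ubnP #|supp a :|: supp b|.
elim: n a b f le_n mina minb sa sb ae af bf bg => // n IHn a b f le_n mina minb sa sb ae af bf bg.
have [ag|ag] := eqVneq (a g) 0; last by exists a.
have [be|be] := eqVneq (b e) 0; last by exists b.
have [aC _ amin] := mina; have [bC _ bmin] := minb.
(* Cancelling f from a with b keeps the value at e, as b e = 0; cancelling f from b with a keeps the
   value at g. *)
have [_ sa' a'E] := eliminate a bf.
have [_ sb' b'E] := eliminate b af.
rewrite setUC in sb'.
have a'C := lin_code_subZ (a f / b f) linC aC bC.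
have b'C := lin_code_subZ (b f / a f) linC bC aC.
have [|d3 [min3 s3 d3e]] := minimal_word_through linC a'C (e := e).
  by rewrite a'E.
have [|d4 [min4 s4 d4g]] := minimal_word_through linC b'C (e := g).
  by rewrite b'E.
have {}s3 := subset_trans s3 sa'; have {}s4 := subset_trans s4 sb'.
have sU : (supp a :|: supp b) :\ f \subset X.
  by apply: subset_trans (subD1set _ _) _; rewrite subUset sa.
have s3X := subset_trans s3 sU; have s4X := subset_trans s4 sU.
have fU : f \in supp a :|: supp b by rewrite !inE af.
have small D : D \subset (supp a :|: supp b) :\ f -> (#|D| < n)%N.
  move/subset_leq_card => leD; apply: leq_ltn_trans leD _.
  by move: le_n; rewrite (cardsD1 f (_ :|: _)) fU.
(* A nonzero word avoiding f cannot be supported inside a or inside b, by minimality of these. *)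
have notin d h : d \in C -> d h != 0 -> supp d \subset (supp a :|: supp b) :\ f ->
    (exists2 x, x \in supp d & x \notin supp a) /\ (exists2 x, x \in supp d & x \notin supp b).
  move=> dC dh sd; split; apply/subsetPn; apply/negP => sub.
    have /(amin _ dC) /setP/(_ h) : supp d \proper supp a.
      apply/properP; split=> //; exists f; first by rewrite inE.
      by apply/negP => /(subsetP sd); rewrite !inE eqxx.
    by rewrite !inE dh.
  have /(bmin _ dC) /setP/(_ h) : supp d \proper supp b.
    apply/properP; split=> //; exists f; first by rewrite inE.
    by apply/negP => /(subsetP sd); rewrite !inE eqxx.
  by rewrite !inE dh.
have [d3C _ _] := min3; have [d4C _ _] := min4.
have [[x x3 xa] _] := notin _ _ d3C d3e s3.
have [_ [y y4 yb]] := notin _ _ d4C d4g s4.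
have xb : x \in supp b.
  by have := subsetP s3 _ x3; rewrite in_setD1 in_setU (negPf xa) => /andP [].
have ya : y \in supp a.
  by have := subsetP s4 _ y4; rewrite in_setD1 in_setU (negPf yb) orbF => /andP [].
(* If d3 and d4 meet in y, their union omits f. Otherwise d3 meets b in x, and their union omits y.
   Either way the union shrinks. *)
have [y3|y3] := boolP (y \in supp d3).
  rewrite !inE in y3 y4.
  by apply: (IHn d3 d4 y) => //; apply: small; rewrite subUset s3.
rewrite !inE in x3 xb.
rewrite ltnS in le_n.
apply: (IHn d3 b x) => //; apply: leq_trans le_n; apply/proper_card/properP; split.
  by rewrite subUset subsetUr (subset_trans s3 (subD1set _ _)).
by exists y; [rewrite inE ya | rewrite inE negb_or y3].
Qed.

Lemma connP C r X e f : rank_on C r X ->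
  conn r X e f <-> e = f \/ linked C X e f.
Proof.
move=> rX; split.
  case/orP=> [/eqP|/existsP [D /and3P [/(is_circuitP D rX (subxx _)) [c [cmin <- sD]]]]]; first by left.
  by rewrite !inE; right; exists c.
case=> [->|[c [cmin sc ce cf]]]; rewrite /conn ?eqxx //.
apply/orP; right; apply/existsP; exists (supp c); rewrite !inE ce cf !andbT.
by apply/(is_circuitP _ rX (subxx _)); exists c.
Qed.

Lemma conn_refl (r : {set E} -> nat) X e : conn r X e e.
Proof. by rewrite /conn eqxx. Qed.

Lemma conn_sym (r : {set E} -> nat) X e f : conn r X e f = conn r X f e.
Proof.
rewrite /conn eq_sym; congr (_ || _); apply: eq_existsb => D.
by rewrite [(e \in D) && _]andbC.
Qed.

Lemma conn_trans C r X : lin_code C -> rank_on C r X -> transitive (conn r X).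
Proof.
move=> linC rX f e g /(connP _ _ rX) ef /(connP _ _ rX) fg; apply/(connP _ _ rX).
case: ef => [->//|ef]; case: fg => [<-|fg]; first by right.
by right; apply: linked_trans ef fg.
Qed.

(** * Separators and components of a code *)

Definition crop Z c : {ffun E -> F} := [ffun x => if x \in Z then c x else 0].

Definition separates C X Z : Prop :=
  forall c, c \in C -> supp c \subset X -> crop Z c \in C.

Definition component (r : {set E} -> nat) X e : {set E} := [set f in X | conn r X e f].

(** Induction on the support: subtract from c a multiple of a minimal word d through some y of its
    support. The support of d lies wholly inside or wholly outside the component, so cropping d
    gives d or 0. *)
Lemma component_separates C r X e : lin_code C -> rank_on C r X ->
  separates C X (component r X e).
Proof.
move=> linC rX c; set Z := component _ _ _.
have [n le_n] := ubnP #|supp c|; elim: n c le_n => // n IHn c le_n cC scX.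
have [c0|/set0Pn [y]] := eqVneq (supp c) set0.
  have -> : crop Z c = c; last by [].
  apply/ffunP => x; rewrite ffunE; case: ifP => // _.
  have : supp c \subset set0 by rewrite c0.
  by move/suppP/(_ x) => ->; rewrite ?inE.
rewrite inE => cy; have [d [dmin sd dy]] := minimal_word_through linC cC cy.
have [dC _ _] := dmin; have [c'y sc' c'E] := eliminate c dy.
have cropd : crop Z d \in C.
  have dZ x : d x != 0 -> (x \in Z) = (y \in Z).
    move=> dx; have xy : conn r X x y.
      by apply/(connP _ _ rX); right; exists d; split=> //; apply: subset_trans scX.
    rewrite !inE (subsetP scX) ?(subsetP scX y) ?inE //=; last first.
      by have := subsetP sd x; rewrite !inE; apply.
    apply/idP/idP => ex; first exact: (conn_trans linC rX ex xy).
    by apply: (conn_trans linC rX ex); rewrite conn_sym.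
  have [yZ|yZ] := boolP (y \in Z).
    have -> : crop Z d = d; last by [].
    apply/ffunP => x; rewrite ffunE; have [->|/dZ ->] := eqVneq (d x) 0; first by rewrite if_same.
    by rewrite yZ.
  have -> : crop Z d = [ffun => 0]; last by case: linC.
  apply/ffunP => x; rewrite !ffunE; have [->|/dZ ->] := eqVneq (d x) 0; first by rewrite if_same.
  by rewrite (negPf yZ).
rewrite (setUidPl sd) in sc'.
have c''C := lin_code_subZ (c y / d y) linC cC dC.
have ysc : y \in supp c by rewrite inE.
have lt' : (#|supp [ffun x => (c x - c y / d y * d x)%R]| < n)%N.
  apply: leq_ltn_trans (subset_leq_card sc') _.
  by move: le_n; rewrite (cardsD1 y (supp c)) ysc.
have cropc' := IHn _ lt' c''C (subset_trans sc' (subset_trans (subD1set _ _) scX)).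
have := linC.2 (c y / d y) _ _ cropd cropc'.
congr (_ \in C); apply/ffunP => x; rewrite !ffunE; case: ifP => _; last by rewrite mulr0 addr0.
by rewrite addrC subrK.
Qed.

End Codes.

(** * Recursive structure of deletion-depth *)

(** Any sufficient fuel is accepted, so fuels of different sizes never have to be reconciled. *)
Definition depth_le (E : finType) (r : {set E} -> nat) (X : {set E}) (d : nat) : Prop :=
  exists k, (#|X| <= k /\ ddf r k X <= d)%N.

Lemma bigmin_le (I : finType) (A : {set I}) (f : I -> nat) n i :
  i \in A -> (\big[minn/n]_(i in A) f i <= f i)%N.
Proof.
move=> iA; have := mem_index_enum i; elim: (index_enum I) => // j s IHs.
rewrite inE big_cons => /predU1P [<-|/IHs le_i]; first by rewrite iA geq_minl.
by case: ifP => // _; apply: leq_trans (geq_minr _ _) le_i.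
Qed.

Lemma ddf_le_card (E : finType) (r : {set E} -> nat) k X : (ddf r k X <= #|X|)%N.
Proof.
elim: k X => //= k IHk X; case: (leqP #|X| 1) => // X1; case: ifP => _; last first.
  apply/bigmax_leqP => Y /imsetP [e _ ->]; apply: leq_trans (IHk _) _.
  by apply: subset_leq_card; apply/subsetP => x; rewrite inE => /andP [].
have /card_gt0P [e eX] := ltnW X1.
apply: leq_ltn_trans (bigmin_le _ _ eX) _.
by apply: leq_ltn_trans (IHk _) _; rewrite (cardsD1 e X) eX.
Qed.

Lemma bigmin_leqP (I : finType) (A : {set I}) (f : I -> nat) n d :
  (\big[minn/n]_(i in A) f i <= d)%N <-> (n <= d)%N \/ exists2 i, i \in A & (f i <= d)%N.
Proof.
split.
  apply: (big_ind (fun m => m <= d -> n <= d \/ exists2 i, i \in A & f i <= d)%N).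
  - by left.
  - by move=> a b IHa IHb; rewrite geq_min => /orP [/IHa|/IHb].
  - by move=> i iA fi; right; exists i.
case=> [le_nd|[i iA]]; last by apply: leq_trans; apply: bigmin_le.
apply: leq_trans le_nd; elim: (index_enum I) => [|i s IHs]; first by rewrite big_nil.
by rewrite big_cons; case: ifP => // _; apply: leq_trans (geq_minr _ _) IHs.
Qed.

Lemma connected_delete (E : finType) (r : {set E} -> nat) X d :
  X != set0 -> connectedb r X -> depth_le r X d ->
  exists2 e, e \in X & exists2 d', d = d'.+1 & depth_le r (X :\ e) d'.
Proof.
move=> X0 cX [[|k] [leXk]]; first by move: leXk; rewrite leqn0 cards_eq0 (negPf X0).
rewrite /= cX; case: (leqP #|X| 1) => X1 led.
  case/set0Pn: X0 => e eX; exists e => //; rewrite (cardsD1 e) eX in X1 led.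
  case: d led => // d _; exists d => //; exists 0%N; split=> //.
case: d led => // d; rewrite ltnS => /bigmin_leqP led.
have small e : e \in X -> (#|X :\ e| < #|X|)%N by move=> eX; rewrite (cardsD1 e X) eX.
have [e eX de] : exists2 e, e \in X & (ddf r k (X :\ e) <= d)%N.
  (* If the default #|X| of the minimum is at most d, every element works, because the depth never
     exceeds the number of elements. *)
  case: led => // led; have [e eX] := set0Pn _ X0; exists e => //.
  by apply: leq_trans (ddf_le_card _ _ _) _; apply: leq_trans (ltnW (small e eX)) led.
exists e => //; exists d => //; exists k; split=> //.
by rewrite -ltnS; apply: leq_trans (small e eX) leXk.
Qed.

(** A circuit of X through a and b links a to each of its elements, so it stays inside the
    component. *)
Lemma component_connected (F : fieldType) (E : finType) (C : pred {ffun E -> F}) r X e :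
  lin_code C -> rank_on C r X -> connectedb r (component r X e).
Proof.
move=> linC rX; set Z := component r X e.
have sZX : Z \subset X by apply/subsetP => x; rewrite inE => /andP [].
apply/forall_inP => a aZ; apply/forall_inP => b bZ.
have ea : conn r X e a by move: aZ; rewrite inE => /andP [].
have eb : conn r X e b by move: bZ; rewrite inE => /andP [].
have : conn r X a b by rewrite conn_sym in ea; apply: (conn_trans linC rX) ea eb.
case/orP=> [/eqP ->|/existsP [D /and3P [cD aD bD]]]; first exact: conn_refl.
apply/orP; right; apply/existsP; exists D; rewrite aD bD !andbT.
case/and3P: (cD) => sDX D1 D2; apply/and3P; split=> //.
apply/subsetP => x xD; rewrite inE (subsetP sDX) //=.
apply: (conn_trans linC rX) ea _; apply/orP; right; apply/existsP; exists D.
by rewrite cD aD.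
Qed.

(** The list of components, in the form that Higman's lemma consumes; it is empty when X is, and
    just X when X is connected. *)
Lemma decompose (F : fieldType) (E : finType) (C : pred {ffun E -> F}) r X d :
  lin_code C -> rank_on C r X -> depth_le r X d ->
  exists Xs : seq {set E}, [/\ \bigcup_(Y <- Xs) Y = X,
    pairwise (fun Y Z : {set E} => [disjoint Y & Z]) Xs &
    forall Y, Y \in Xs ->
      separates C X Y /\ [/\ Y != set0, connectedb r Y & depth_le r Y d]].
Proof.
move=> linC rX [k [leXk ddX]].
have [X0|X0] := eqVneq X set0; first by exists [::]; split; rewrite ?big_nil.
case cX: (connectedb r X).
  exists [:: X]; split=> [||Y]; rewrite ?big_seq1 // inE => /eqP ->; split; last first.
    by split=> //; exists k.
  move=> c cC scX; have -> : crop X c = c; last by [].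
  by apply/ffunP => x; rewrite ffunE; case: ifPn => // /(suppP _ _ scX) ->.
have trans := conn_trans linC rX.
have equiv : {in X & &, equivalence_rel (conn r X)}.
  move=> x y z _ _ _; split=> [|xy]; first exact: conn_refl.
  apply/idP/idP => [xz|]; last exact: trans.
  by apply: trans xz; rewrite conn_sym.
have /and3P [/eqP covX trivX X'0] := equivalence_partitionP equiv.
have compE : components r X = equivalence_partition (conn r X) X by [].
exists (enum (components r X)); split.
- by rewrite big_enum; apply: covX.
- have : uniq (enum (components r X)) := enum_uniq _.
  have : {subset enum (components r X) <= components r X} by move=> Y; rewrite mem_enum.
  elim: (enum _) => //= Y s IHs sub /andP [Ys us]; apply/andP; split; last first.
    by apply: IHs us => Z Zs; apply: sub; rewrite inE Zs orbT.
  apply/allP => Z Zs; apply: (trivIsetP trivX); rewrite -?compE ?sub ?inE ?eqxx ?Zs ?orbT //.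
  by apply: contraNneq Ys => ->.
move=> Y; rewrite mem_enum => YX; have /imsetP [e eX YE] := YX.
have YC : Y = component r X e by [].
split; first by rewrite YC; apply: component_separates.
split.
- by apply/set0Pn; exists e; rewrite YE inE eX conn_refl.
- by rewrite YC; apply: component_connected linC rX.
case: k leXk ddX => [|k] leXk; first by rewrite leqn0 cards_eq0 (negPf X0) in leXk.
rewrite /= cX; case: (leqP #|X| 1) => X1 ddX.
  have /cards1P [x Xx] : #|X| == 1%N by rewrite eqn_leq X1 card_gt0.
  move: cX; rewrite /connectedb Xx => /negP []; apply/forall_inP => a; rewrite inE => /eqP ->.
  by apply/forall_inP => b; rewrite inE => /eqP ->; apply: conn_refl.
exists k; split; last by apply: leq_trans ddX; apply: (leq_bigmax_cond (F := ddf r k)).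
(* A component of a disconnected X is a proper subset, so one unit less of fuel is still enough. *)
rewrite -ltnS; apply: leq_trans leXk; apply: proper_card.
rewrite properE; apply/andP; split; first by apply/subsetP => x; rewrite YE inE => /andP [].
apply: contraFN cX => /subsetP sXY; apply/forall_inP => a aX; apply/forall_inP => b bX.
have := sXY a aX; have := sXY b bX; rewrite YE !inE => /andP [_ eb] /andP [_ ea].
by apply: trans eb; rewrite conn_sym.
Qed.

(** * Embeddings of labelled codes *)

Section Embedding.
Variables (F : fieldType) (Q : Type) (E E' : finType).
Variables (C : pred {ffun E -> F}) (C' : pred {ffun E' -> F}).
Implicit Types (X : {set E}) (Y : {set E'}).

(* The last two clauses say that the words of C supported in X are exactly the
   pullbacks along phi of the words of C' supported in Y; dually, the matroid on
   X is obtained from the one on Y by contracting Y \ phi(X). *)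
Definition embedding X Y (lab : E -> Q) (lab' : E' -> Q) (phi : E -> E') : Prop :=
  [/\ {in X &, injective phi},
      forall x, x \in X -> phi x \in Y /\ lab x = lab' (phi x),
      forall c, c \in C -> supp c \subset X ->
        exists c', [/\ c' \in C', supp c' \subset Y & forall x, x \in X -> c x = c' (phi x)] &
      forall c', c' \in C' -> supp c' \subset Y ->
        exists c, [/\ c \in C, supp c \subset X & forall x, x \in X -> c x = c' (phi x)]].

Definition embeds X Y lab lab' : Prop := exists phi, embedding X Y lab lab' phi.

End Embedding.

(** * Direct sums and pivots of embeddings *)

Lemma supp_crop (F : fieldType) (E : finType) (Z : {set E}) (c : {ffun E -> F}) :
  supp (crop Z c) \subset Z.
Proof. by apply/suppP => x /negPf xZ; rewrite ffunE xZ. Qed.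

Lemma lin_code_add (F : fieldType) (E : finType) (C : pred {ffun E -> F}) c d :
  lin_code C -> c \in C -> d \in C -> [ffun x => c x + d x] \in C.
Proof.
move=> [_ linC] cC dC; have := linC 1 c d cC dC.
by congr (_ \in C); apply/ffunP => x; rewrite !ffunE mul1r.
Qed.

Lemma separatesC (F : fieldType) (E : finType) (C : pred {ffun E -> F}) (Y Z : {set E}) :
  lin_code C -> [disjoint Y & Z] -> separates C (Y :|: Z) Y -> separates C (Y :|: Z) Z.
Proof.
move=> linC dYZ sepY c cC sc; have := lin_code_subZ 1 linC cC (sepY c cC sc).
congr (_ \in C); apply/ffunP => x; rewrite !ffunE mul1r.
have [xY|xY] := boolP (x \in Y).
  by rewrite subrr (disjointFr dYZ xY).
rewrite subr0; case: ifPn => // xZ; apply: (suppP _ _ sc).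
by rewrite inE negb_or xY.
Qed.

Lemma separates_sub (F : fieldType) (E : finType) (C : pred {ffun E -> F}) (X X' Z : {set E}) :
  X' \subset X -> separates C X Z -> separates C X' Z.
Proof. by move=> sX sep c cC sc; apply: sep => //; apply: subset_trans sX. Qed.

Section Gluing.
Variables (F : fieldType) (Q : Type) (E E' : finType).
Variables (C : pred {ffun E -> F}) (C' : pred {ffun E' -> F}).
Variables (lab : E -> Q) (lab' : E' -> Q) (pt' : E').
Hypotheses (linC : lin_code C) (linC' : lin_code C').
Implicit Types (X : {set E}) (Y : {set E'}).
Let emb X Y := embeds C C' X Y lab lab'.

Lemma embeds_empty Y : emb set0 Y.
Proof.
have [C0 _] := linC; have [C'0 _] := linC'; exists (fun=> pt'); split.
- by move=> x y; rewrite inE.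
- by move=> x; rewrite inE.
- move=> c _ _; exists [ffun => 0]; split=> // [|x]; last by rewrite inE.
  by apply/suppP => x _; rewrite ffunE.
move=> c' _ _; exists [ffun => 0]; split=> // [|x]; last by rewrite inE.
by apply/suppP => x _; rewrite ffunE.
Qed.

(** Extra summands of the target are contracted away: a word on Y' is cropped to Y before it is
    pulled back. *)
Lemma embeds_widen X Y Y' :
  Y \subset Y' -> separates C' Y' Y -> emb X Y -> emb X Y'.
Proof.
move=> sY sep [phi [inj im lift proj]]; exists phi; split=> //.
- by move=> x xX; have [pY ->] := im x xX; split=> //; apply: (subsetP sY).
- move=> c cC sc; have [c' [c'C sc' cE]] := lift c cC sc.
  by exists c'; split=> //; apply: subset_trans sY.
move=> c' c'C sc'; have [c [cC sc cE]] := proj _ (sep c' c'C sc') (supp_crop _ _).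
exists c; split=> // x xX; rewrite cE // ffunE.
by have [-> _] := im x xX.
Qed.

(** A word is the sum of its crops to the two summands; lift or pull back each crop and add the
    results. *)
Lemma embeds_union X1 X2 Y1 Y2 :
  [disjoint X1 & X2] -> [disjoint Y1 & Y2] ->
  separates C (X1 :|: X2) X1 -> separates C' (Y1 :|: Y2) Y1 ->
  emb X1 Y1 -> emb X2 Y2 -> emb (X1 :|: X2) (Y1 :|: Y2).
Proof.
move=> dX dY sepX1 sepY1 [f1 [inj1 im1 lift1 proj1]] [f2 [inj2 im2 lift2 proj2]].
have sepX2 := separatesC linC dX sepX1; have sepY2 := separatesC linC' dY sepY1.
pose f x := if x \in X1 then f1 x else f2 x.
have fE1 x : x \in X1 -> f x = f1 x by rewrite /f => ->.
have fE2 x : x \in X2 -> f x = f2 x by rewrite /f => xX; rewrite (disjointFl dX xX).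
have f1Y x : x \in X1 -> (f1 x \in Y1) * (f1 x \in Y2 = false).
  by move=> xX; have [fY _] := im1 x xX; rewrite fY (disjointFr dY fY).
have f2Y x : x \in X2 -> (f2 x \in Y2) * (f2 x \in Y1 = false).
  by move=> xX; have [fY _] := im2 x xX; rewrite fY (disjointFl dY fY).
exists f; split.
- move=> x y /setUP [xX|xX] /setUP [yX|yX]; rewrite ?(fE1 _ xX) ?(fE2 _ xX) ?(fE1 _ yX) ?(fE2 _ yX).
  + exact: inj1.
  + by move=> e; have := (f1Y x xX).2; rewrite e f2Y.
  + by move=> e; have := (f2Y x xX).2; rewrite e f1Y.
  + exact: inj2.
- move=> x /setUP [xX|xX]; rewrite ?(fE1 _ xX) ?(fE2 _ xX) inE.
    by have [-> ->] := im1 x xX.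
  by have [-> ->] := im2 x xX; rewrite orbT.
- move=> c cC sc.
  have [c1 [c1C sc1 cE1]] := lift1 _ (sepX1 c cC sc) (supp_crop _ _).
  have [c2 [c2C sc2 cE2]] := lift2 _ (sepX2 c cC sc) (supp_crop _ _).
  exists [ffun x => c1 x + c2 x]; split; first exact: lin_code_add.
    apply/suppP => x; rewrite inE negb_or => /andP [x1 x2].
    by rewrite ffunE (suppP _ _ sc1) // (suppP _ _ sc2) // addr0.
  move=> x /setUP [xX|xX]; rewrite ffunE ?(fE1 _ xX) ?(fE2 _ xX).
    by rewrite -cE1 // ffunE xX (suppP _ _ sc2) ?addr0 // f1Y.
  by rewrite -cE2 // ffunE xX (suppP _ _ sc1) ?add0r // f2Y.
move=> c cC sc.
have [c1 [c1C sc1 cE1]] := proj1 _ (sepY1 c cC sc) (supp_crop _ _).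
have [c2 [c2C sc2 cE2]] := proj2 _ (sepY2 c cC sc) (supp_crop _ _).
exists [ffun x => c1 x + c2 x]; split; first exact: lin_code_add.
  apply/suppP => x; rewrite inE negb_or => /andP [x1 x2].
  by rewrite ffunE (suppP _ _ sc1) // (suppP _ _ sc2) // addr0.
move=> x /setUP [xX|xX]; rewrite ffunE ?(fE1 _ xX) ?(fE2 _ xX).
  by rewrite cE1 // ffunE f1Y // (suppP _ _ sc2) ?addr0 // (disjointFr dX xX).
by rewrite cE2 // ffunE f2Y // (suppP _ _ sc1) ?add0r // (disjointFl dX xX).
Qed.

Lemma disjoint_bigcup (T : finType) (Y : {set T}) (s : seq {set T}) :
  all (fun Z : {set T} => [disjoint Y & Z]) s -> [disjoint Y & \bigcup_(Z <- s) Z].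
Proof.
elim: s => [|Z s IHs] /=; first by rewrite big_nil -setI_eq0 setI0.
case/andP=> dYZ /IHs; rewrite big_cons -!setI_eq0 setIUr => /eqP ->.
by rewrite setU0 setI_eq0.
Qed.

(** Follows the recursion of [hemb]: a skipped summand is handled by [embeds_widen], a matched one
    by [embeds_union]. *)
Lemma embeds_sum Xs Ys :
  hemb emb Xs Ys ->
  pairwise (fun Y Z : {set E} => [disjoint Y & Z]) Xs ->
  pairwise (fun Y Z : {set E'} => [disjoint Y & Z]) Ys ->
  (forall X, X \in Xs -> separates C (\bigcup_(X <- Xs) X) X) ->
  (forall Y, Y \in Ys -> separates C' (\bigcup_(Y <- Ys) Y) Y) ->
  emb (\bigcup_(X <- Xs) X) (\bigcup_(Y <- Ys) Y).
Proof.
elim: Ys Xs => [|Y Ys IHs] [|X Xs] //; try by rewrite big_nil => *; apply: embeds_empty.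
move=> h dXs /= /andP [dY dYs] sepX sepY.
have sepY' Z : Z \in Ys -> separates C' (\bigcup_(Y <- Ys) Y) Z.
  move=> ZY; apply: separates_sub (sepY Z _); last by rewrite inE ZY orbT.
  by rewrite big_cons subsetUr.
have dYU := disjoint_bigcup dY.
have sepY1 := sepY Y (mem_head _ _); rewrite big_cons in sepY1.
case: h => [h|[hXY h]].
  rewrite (big_cons _ _ Y); apply: embeds_widen (IHs _ h dXs dYs sepX sepY').
    exact: subsetUr.
  exact: separatesC sepY1.
have /= /andP [dX dXs'] := dXs.
have sepX1 := sepX X (mem_head _ _); rewrite big_cons in sepX1.
rewrite !big_cons; apply: embeds_union => //; first exact: disjoint_bigcup.
apply: IHs => // Z ZX; apply: separates_sub (sepX Z _); last by rewrite inE ZX orbT.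
by rewrite big_cons subsetUr.
Qed.

(* A word with g e = 1 (or the zero word, if e lies in no support) splits C as
   the words vanishing at e plus the multiples of g; since e and phi e
   carry the same value of g, embeddings of the first summand extend. *)
Lemma embeds_pivot X Y e e' g g' :
  e \in X -> e' \in Y -> g \in C -> g' \in C' -> supp g \subset X -> supp g' \subset Y ->
  (forall c, c \in C -> supp c \subset X -> c e * g e = c e) ->
  (forall c, c \in C' -> supp c \subset Y -> c e' * g' e' = c e') ->
  g e = g' e' -> lab e = lab' e' ->
  embeds C C' (X :\ e) (Y :\ e') (fun x => (g x, lab x)) (fun x => (g' x, lab' x)) ->
  emb X Y.
Proof.
move=> eX eY gC g'C sg sg' ge ge' gg ll [f0 [inj0 im0 lift0 proj0]].
pose f x := if x == e then e' else f0 x.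
have fe : f e = e' by rewrite /f eqxx.
have fE x : x != e -> f x = f0 x by rewrite /f => /negPf ->.
have im x : x \in X -> x != e ->
    [/\ f0 x \in Y, f0 x != e', g x = g' (f0 x) & lab x = lab' (f0 x)].
  move=> xX xe; have [|] := im0 x; first by rewrite !inE xe.
  by rewrite !inE => /andP [-> ->] [-> ->].
exists f; split.
- move=> x y xX yX; have [->|xe] := eqVneq x e; have [->|ye] := eqVneq y e => //.
  + by rewrite fe fE // => e1; have [_ /eqP []] := im y yX ye.
  + by rewrite fe fE // => e1; have [_ /eqP []] := im x xX xe.
  by rewrite !fE //; apply: inj0; rewrite !inE ?xe ?ye.
- move=> x xX; have [->|xe] := eqVneq x e; first by rewrite fe.
  by rewrite fE //; have [] := im x xX xe.
(* c - c(e) g vanishes at e, so it lifts along [f0]; adding c(e) g' lifts c itself, since g agrees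
   with g' along [f]. *)
- move=> c cC sc; have c1C := lin_code_subZ (c e) linC cC gC.
  have [|c' [c'C sc' cE]] := lift0 _ c1C.
    apply/suppP => x; rewrite !inE ffunE negb_and negbK => /orP [/eqP ->|xX].
      by rewrite ge ?subrr.
    by rewrite (suppP _ _ sc) // (suppP _ _ sg) // mulr0 subr0.
  exists [ffun x => c e * g' x + c' x]; split; first exact: linC'.2.
    apply/suppP => x xY; rewrite ffunE (suppP _ _ sg') // (suppP _ _ sc').
      by rewrite mulr0 addr0.
    by rewrite !inE (negPf xY) andbF.
  move=> x xX; rewrite ffunE; have [->|xe] := eqVneq x e.
    by rewrite fe -gg ge // (suppP _ _ sc') ?addr0 // !inE eqxx.
  have [_ _ gx _] := im x xX xe.
  by rewrite fE // -cE ?inE ?xe // ffunE -gx addrC subrK.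
move=> c cC sc; have c1C := lin_code_subZ (c e') linC' cC g'C.
have [|c' [c'C sc' cE]] := proj0 _ c1C.
  apply/suppP => x; rewrite !inE ffunE negb_and negbK => /orP [/eqP ->|xX].
    by rewrite ge' ?subrr.
  by rewrite (suppP _ _ sc) // (suppP _ _ sg') // mulr0 subr0.
exists [ffun x => c e' * g x + c' x]; split; first exact: linC.2.
  apply/suppP => x xY; rewrite ffunE (suppP _ _ sg) // (suppP _ _ sc').
    by rewrite mulr0 addr0.
  by rewrite !inE (negPf xY) andbF.
move=> x xX; rewrite ffunE; have [->|xe] := eqVneq x e.
  by rewrite fe gg ge' // (suppP _ _ sc') ?addr0 // !inE eqxx.
have [_ _ gx _] := im x xX xe.
by rewrite fE // cE ?inE ?xe // ffunE -gx addrC subrK.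
Qed.

End Gluing.

Lemma embeds_trans (F : fieldType) (Q : Type) (E1 E2 E3 : finType)
  (C1 : pred {ffun E1 -> F}) (C2 : pred {ffun E2 -> F}) (C3 : pred {ffun E3 -> F})
  X1 X2 X3 (l1 : E1 -> Q) (l2 : E2 -> Q) (l3 : E3 -> Q) :
  embeds C1 C2 X1 X2 l1 l2 -> embeds C2 C3 X2 X3 l2 l3 -> embeds C1 C3 X1 X3 l1 l3.
Proof.
move=> [f [injf imf liftf projf]] [g [injg img liftg projg]].
have imfX x : x \in X1 -> f x \in X2 by move=> /imf [].
exists (g \o f); split.
- by move=> x y xX yX /injg /injf; apply; rewrite ?imfX.
- by move=> x /imf [/img [? <-] ->].
- move=> c cC /(liftf _ cC) [c2 [c2C /(liftg _ c2C) [c3 [c3C sc3 cE']] cE]].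
  by exists c3; split=> // x xX; rewrite cE // cE' ?imfX.
move=> c cC /(projg _ cC) [c2 [c2C /(projf _ c2C) [c3 [c3C sc3 cE']] cE]].
by exists c3; split=> // x xX; rewrite cE' // cE ?imfX.
Qed.

(** Scale a word that is nonzero at e to value 1 there; if there is none, every c e is 0 and the
    zero word does. The equation covers both cases. *)
Lemma pivot_word (F : fieldType) (E : finType) (C : pred {ffun E -> F}) (X : {set E}) e :
  lin_code C -> exists g, [/\ g \in C, supp g \subset X &
    forall c, c \in C -> supp c \subset X -> c e * g e = c e].
Proof.
move=> linC.
case: (classic (exists g, [/\ g \in C, supp g \subset X & g e != 0])) => [[g [gC sg ge]]|no].
  have [C0 lin] := linC; exists [ffun x => (g e)^-1 * g x + [ffun => 0] x]; split.
  - exact: lin.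
  - by apply/suppP => x xX; rewrite !ffunE (suppP _ _ sg x) // mulr0 addr0.
  by move=> c _ _; rewrite !ffunE addr0 mulVf // mulr1.
exists [ffun => 0]; split; first by case: linC.
  by apply/suppP => x _; rewrite ffunE.
move=> c cC sc; rewrite ffunE mulr0; apply/eqP; rewrite eq_sym.
by apply: contraT => ce; case: no; exists c.
Qed.

(** * Labelled pieces of bounded deletion-depth are well-quasi-ordered *)

Section Pieces.
Variable F : finFieldType.

(** Deletion and restriction change only [domain], so the carrier, code and rank stay fixed. [point]
    is a default value for maps into the carrier. *)
Record piece (Q : Type) := Piece {
  carrier : finType;
  point : carrier;
  code : pred {ffun carrier -> F};
  rank : {set carrier} -> nat;
  domain : {set carrier};
  label : carrier -> Q }.

Arguments code [Q] p _ : rename.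
Arguments rank [Q] p _ : rename.
Arguments label [Q] p _ : rename.

Definition piece_le (Q : Type) (p q : piece Q) : Prop :=
  embeds (code p) (code q) (domain p) (domain q) (label p) (label q).

Definition depth_piece (Q : Type) (d : nat) (p : piece Q) : Prop :=
  [/\ lin_code (code p), rank_on (code p) (rank p) (domain p) &
      depth_le (rank p) (domain p) d].

Definition connected_piece (Q : Type) (d : nat) (p : piece Q) : Prop :=
  [/\ depth_piece d p, domain p != set0 & connectedb (rank p) (domain p)].

Lemma piece_le_trans (Q : Type) (p q s : piece Q) :
  piece_le p q -> piece_le q s -> piece_le p s.
Proof. exact: embeds_trans. Qed.

(** Apply Higman's lemma to the lists of connected summands and glue the resulting embeddings with
    [embeds_sum]. *)
Lemma wqo_depth_piece (Q : Type) (d : nat) :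
  wqo (@connected_piece Q d) (@piece_le Q) -> wqo (@depth_piece Q d) (@piece_le Q).
Proof.
move=> wqc s sP.
have parts n := let: And3 l r d := sP n in decompose l r d.
pose Xs n := proj1_sig (constructive_indefinite_description _ (parts n)).
have XsP n := proj2_sig (constructive_indefinite_description _ (parts n)).
pose restr (p : piece Q) Y := Piece (point p) (code p) (rank p) Y (label p).
have [|i [j [ltij h]]] := higman (@piece_le_trans Q) wqc (s := fun n => map (restr (s n)) (Xs n)).
  move=> n; have [UX _ allX] := XsP n; have [lin rk _] := sP n; rewrite -/(Xs n) in UX allX.
  have sub Y : Y \in Xs n -> Y \subset domain (s n).
    by move=> YX; rewrite -UX (big_rem _ YX) subsetUl.
  have : {subset Xs n <= Xs n} by [].
  elim: {1 3}(Xs n) => [|Y Ys IHs] sYs /=; constructor.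
    have YX : Y \in Xs n by apply: sYs; rewrite mem_head.
    by have [_ [Y0 cY dY]] := allX Y YX; do 2!split=> //; apply: rank_on_sub rk; apply: sub.
  by apply: IHs => Z ZY; apply: sYs; rewrite inE ZY orbT.
exists i, j; split=> //.
have [Ui di alli] := XsP i; have [Uj dj allj] := XsP j.
rewrite -/(Xs i) in Ui di alli; rewrite -/(Xs j) in Uj dj allj.
rewrite /piece_le -Ui -Uj; have [lini _ _] := sP i; have [linj _ _] := sP j.
apply: embeds_sum => //; first exact: point.
- exact: (hemb_map h).
- by move=> X XX; rewrite Ui; have [] := alli X XX.
by move=> X XX; rewrite Uj; have [] := allj X XX.
Qed.

(** Q is quantified inside the induction on d because removing a pivot enlarges the labels from Q to
    F * Q, which is again finite. *)
Theorem wqo_pieces (d : nat) : forall Q : finType, wqo (@depth_piece Q d) (@piece_le Q).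
Proof.
elim: d => [|d IHd] Q; apply: wqo_depth_piece.
  (* At depth 0 there is no nonempty connected piece. *)
  move=> s sP; have [[_ _ dep] dom conX] := sP 0%N.
  by have [e _ []] := connected_delete dom conX dep.
move=> s sP.
have pivots n : exists eg : carrier (s n) * {ffun carrier (s n) -> F},
    [/\ eg.1 \in domain (s n), depth_le (rank (s n)) (domain (s n) :\ eg.1) d,
        eg.2 \in code (s n), supp eg.2 \subset domain (s n) &
        forall c, c \in code (s n) -> supp c \subset domain (s n) ->
          c eg.1 * eg.2 eg.1 = c eg.1].
  have [[lin rk dep] dom conX] := sP n.
  have [e eX [d' [<-] dep']] := connected_delete dom conX dep.
  by have [g [gC sg ge]] := pivot_word (domain (s n)) e lin; exists (e, g).
pose eg n := proj1_sig (constructive_indefinite_description _ (pivots n)).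
have egP n := proj2_sig (constructive_indefinite_description _ (pivots n)).
(* [embeds_pivot] needs equal pivot values and equal pivot labels; finiteness of F * Q gives a
   subsequence on which both are constant. *)
pose col n : F * Q := ((eg n).2 (eg n).1, label (s n) (eg n).1).
have eq_tr (x y z : F * Q) : x = y -> y = z -> x = z by move=> ->.
have [h [hmono hcol]] := wqo_subseq (s := col) eq_tr (@wqo_finite _) (fun=> I).
pose t n : piece (F * Q)%type := Piece (point (s n)) (code (s n)) (rank (s n))
  (domain (s n) :\ (eg n).1) (fun x => ((eg n).2 x, label (s n) x)).
have [n|i [j [ltij tij]]] := IHd (F * Q)%type (t \o h).
  have [_ dep _ _ _] := egP (h n); have [[lin rk _] _ _] := sP (h n).
  by split=> //; apply: rank_on_sub rk; apply: subD1set.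
exists (h i), (h j); split; first exact: hmono.
have [ei _ gi si pi] := egP (h i); have [ej _ gj sj pj] := egP (h j).
have [[lini _ _] _ _] := sP (h i); have [[linj _ _] _ _] := sP (h j).
have [gg ll] := hcol _ _ ltij.
exact: (embeds_pivot lini linj ei ej gi gj si sj pi pj gg ll tij).
Qed.

End Pieces.

(** * Isomorphism invariance of deletion-depth *)

Lemma eq_from_leq (a b : nat) : (forall m, (a <= m)%N <-> (b <= m)%N) -> a = b.
Proof.
by move=> ab; apply/eqP; rewrite eqn_leq; apply/andP; split; apply/ab.
Qed.

Section Isomorphism.
Variables (E E' : finType) (r : {set E} -> nat) (r' : {set E'} -> nat) (f : E -> E').

Definition rank_iso (X : {set E}) : Prop :=
  {in X &, injective f} /\ forall A : {set E}, A \subset X -> r' (f @: A) = r A.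

Lemma rank_iso_sub (X Y : {set E}) : Y \subset X -> rank_iso X -> rank_iso Y.
Proof.
move=> sYX [inj rk]; split=> [x y xY yY|A sA]; first by apply: inj; apply: (subsetP sYX).
by apply: rk; apply: subset_trans sYX.
Qed.

Lemma sub_imset_ex (X : {set E}) (B : {set E'}) :
  B \subset f @: X -> exists2 A : {set E}, A \subset X & B = f @: A.
Proof.
move=> sB; exists [set x in X | f x \in B]; first by apply/subsetP => x; rewrite inE => /andP [].
apply/setP => y; apply/idP/imsetP => [yB|[x]]; last by rewrite inE => /andP [_ fx] ->.
by have /imsetP [x xX yE] := subsetP sB y yB; exists x; rewrite // inE xX -yE.
Qed.

Lemma imset_inj_sub (X A B : {set E}) : {in X &, injective f} ->
  A \subset X -> B \subset X -> (f @: A \subset f @: B) = (A \subset B).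
Proof.
move=> inj sA sB; apply/idP/idP => [/subsetP sAB|]; last exact: imsetS.
apply/subsetP => x xA; have /imsetP [y yB /inj] := sAB _ (imset_f f xA).
by move=> xy; rewrite (xy (subsetP sA x xA) (subsetP sB y yB)).
Qed.

Lemma card_imset_sub (X A : {set E}) : {in X &, injective f} ->
  A \subset X -> #|f @: A| = #|A|.
Proof.
by move=> inj /subsetP sA; apply: card_in_imset => x y /sA xX /sA yX; apply: inj.
Qed.

Lemma is_circuit_iso (X D : {set E}) : rank_iso X -> D \subset X ->
  is_circuit r' (f @: X) (f @: D) = is_circuit r X D.
Proof.
move=> [inj rk] sD; rewrite /is_circuit (imset_inj_sub inj) // sD rk //.
rewrite (card_imset_sub inj) //; congr [&& _, _ & _].
have proper_im (A : {set E}) : A \subset X -> (f @: A \proper f @: D) = (A \proper D).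
  by move=> sA; rewrite !properE (imset_inj_sub inj sA sD) (imset_inj_sub inj sD sA).
apply/forallP/forallP => min A; apply/implyP => pA.
  have sA := subset_trans (proper_sub pA) sD.
  have /implyP := min (f @: A); rewrite proper_im // rk // (card_imset_sub inj) //.
  by apply.
have [A0 sA0 AE] := sub_imset_ex (proper_sub pA).
have sA0X := subset_trans sA0 sD; rewrite AE proper_im // in pA.
by have /implyP := min A0; rewrite AE rk // (card_imset_sub inj) //; apply.
Qed.

Lemma conn_iso (X : {set E}) e g : rank_iso X -> e \in X -> g \in X ->
  conn r' (f @: X) (f e) (f g) = conn r X e g.
Proof.
move=> iso eX gX; have [inj _] := iso; rewrite /conn (inj_in_eq inj) //; congr (_ || _).
have memf (D : {set E}) x : D \subset X -> x \in X -> (f x \in f @: D) = (x \in D).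
  move=> sD xX; apply/imsetP/idP => [[y yD /inj ->]|xD] //; last by exists x.
  exact: (subsetP sD).
apply/existsP/existsP => [[D /and3P [cD eD gD]]|[D /and3P [cD eD gD]]]; last first.
  have /and3P [sD _ _] := cD.
  by exists (f @: D); rewrite (is_circuit_iso iso) // cD !imset_f.
have /and3P [sD _ _] := cD; have [D0 sD0 DE] := sub_imset_ex sD.
by exists D0; move: cD eD gD; rewrite DE (is_circuit_iso iso) // !memf // => -> -> ->.
Qed.

Lemma connectedb_iso (X : {set E}) : rank_iso X ->
  connectedb r' (f @: X) = connectedb r X.
Proof.
move=> iso; apply/forall_inP/forall_inP => conX e eX; apply/forall_inP => g gX.
  by rewrite -(conn_iso iso) //; apply: (forall_inP (conX _ _)); rewrite imset_f.
have /imsetP [e0 e0X ->] := eX; have /imsetP [g0 g0X ->] := gX.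
by rewrite (conn_iso iso) //; apply: (forall_inP (conX _ _)).
Qed.

Lemma components_iso (X : {set E}) : rank_iso X ->
  components r' (f @: X) = (fun Y : {set E} => f @: Y) @: components r X.
Proof.
move=> iso; rewrite /components -[LHS]imset_comp -[RHS]imset_comp.
apply: eq_in_imset => e eX /=; apply/setP => y; rewrite inE.
apply/andP/imsetP => [[/imsetP [x xX ->]]|[x]].
  by rewrite (conn_iso iso) // => ex; exists x; rewrite // inE xX.
by rewrite inE => /andP [xX ex] ->; rewrite imset_f // (conn_iso iso).
Qed.

Lemma ddf_iso k (X : {set E}) : rank_iso X -> ddf r' k (f @: X) = ddf r k X.
Proof.
elim: k X => //= k IHk X iso; have [inj _] := iso.
rewrite (card_imset_sub inj) // (connectedb_iso iso) (components_iso iso).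
case: leqP => // _; case: ifP => _.
  (* The two minima range over different types, so they are compared through their upper bounds;
     their defaults agree. *)
  congr _.+1; apply: eq_from_leq => m; rewrite !bigmin_leqP.
  have im e : e \in X -> f @: X :\ f e = f @: (X :\ e).
    move=> eX; apply/setP => y; rewrite inE in_set1.
    apply/andP/imsetP => [[ye /imsetP [x xX yE]]|[x]].
      by exists x; rewrite // !inE xX andbT; apply: contraNneq ye => <-; rewrite yE.
    rewrite !inE => /andP [xe xX] ->; split; last exact: imset_f.
    by apply: contraNneq xe => /inj ->.
  have IH e : e \in X -> ddf r' k (f @: X :\ f e) = ddf r k (X :\ e).
    by move=> eX; rewrite im // IHk //; apply: rank_iso_sub iso; apply: subD1set.
  split=> [[|[_ /imsetP [e eX ->]]]|[|[e eX]]]; try by left.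
    by rewrite IH //; right; exists e.
  by right; exists (f e); rewrite ?imset_f ?IH.
have IH Y : Y \in components r X -> ddf r' k (f @: Y) = ddf r k Y.
  move=> /imsetP [e _ ->]; apply: IHk; apply: rank_iso_sub iso.
  by apply/subsetP => x; rewrite inE => /andP [].
apply: eq_from_leq => m; split=> /bigmax_leqP le; apply/bigmax_leqP.
  by move=> Y YX; rewrite -IH //; apply: le; apply: imset_f.
by move=> _ /imsetP [Y YX ->]; rewrite IH //; apply: le.
Qed.

End Isomorphism.

(** * Embeddings are contractions *)

(** Build A one element at a time: lifting and pulling back words shows that the rank of A and the
    rank of its image together with S grow at the same steps. *)
Lemma contract_rank (F : fieldType) (Q : Type) (E E' : finType)
  (C : pred {ffun E -> F}) (C' : pred {ffun E' -> F}) (X : {set E}) (Y : {set E'})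
  (lab : E -> Q) (lab' : E' -> Q) (f : E -> E') r r' :
  rank_on C r X -> rank_on C' r' Y -> embedding C C' X Y lab lab' f ->
  forall A : {set E}, A \subset X -> contract_rk r' (Y :\: f @: X) (f @: A) = r A.
Proof.
move=> [r0 rS] [_ rS'] [inj im lift proj] A; set S := _ :\: _.
suff rk : A \subset X -> r' (f @: A :|: S) = (r A + r' S)%N.
  by move=> sA; rewrite /contract_rk rk // addnK.
have sfX : f @: X \subset Y by apply/subsetP => _ /imsetP [x /im [fY _] ->].
have [n le_n] := ubnP #|A|; elim: n A le_n => // n IHn A le_n sAX.
have [->|/set0Pn [x xA]] := eqVneq A set0; first by rewrite imset0 set0U r0.
set B := A :\ x; have AE : A = x |: B by rewrite setD1K.
have xX := subsetP sAX x xA.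
have sBX : B \subset X := subset_trans (subD1set _ _) sAX.
have xB : x \notin B by rewrite setD11.
have IHB : r' (f @: B :|: S) = (r B + r' S)%N.
  by apply: IHn => //; move: le_n; rewrite (cardsD1 x A) xA.
have fxBS : f x \notin f @: B :|: S.
  rewrite !inE (imset_f f xX) orbF; apply/imsetP => -[y yB /inj xy].
  by move: xB; rewrite xy ?yB // (subsetP sBX).
have fAS : f @: A :|: S = f x |: (f @: B :|: S) by rewrite AE imsetU1 setUA.
have sAS : f x |: (f @: B :|: S) \subset Y.
  rewrite -fAS subUset subsetDl andbT; apply: subset_trans sfX; exact: imsetS.
have sxB : x |: B \subset X by rewrite -AE.
have sfAS : f @: A :|: S \subset Y by rewrite fAS.
have [rA rA0] := rS _ _ sxB xB.
have [rA' rA0'] := rS' _ _ sAS fxBS; rewrite -AE in rA rA0.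
have same : r A = r B <-> r' (f x |: (f @: B :|: S)) = r' (f @: B :|: S).
  rewrite rA0 rA0' -fAS; split=> -[c [cC sc cx]].
    have [c' [c'C sc' cE]] := lift c cC (subset_trans sc sAX).
    exists c'; split=> //; last by rewrite -cE.
    apply/subsetP => y; rewrite inE => c'y.
    have yY : y \in Y by apply: (subsetP sc'); rewrite inE.
    (* Outside the image of X the lifted word lives in S, so only its values on the image need
       checking. *)
    have [/imsetP [z zX yE]|yX] := boolP (y \in f @: X); last by rewrite !inE yX yY orbT.
    rewrite inE yE imset_f //; apply: (subsetP sc).
    by rewrite inE cE // -yE.
  have [c1 [c1C sc1 cE]] := proj c cC (subset_trans sc sfAS).
  exists c1; split=> //; last by rewrite cE.
  apply/subsetP => y c1y; have yX := subsetP sc1 y c1y.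
  have : f y \in f @: A :|: S by apply: (subsetP sc); move: c1y; rewrite !inE cE.
  rewrite !inE (imset_f f yX) orbF => /imsetP [z zA /inj ->] //.
  exact: (subsetP sAX).
rewrite fAS; case: rA same => rA; case: rA' => rA' same.
- by rewrite rA' rA.
- by have := same.1 rA; rewrite rA' => /eqP; rewrite eqn_leq ltnn.
- by have := same.2 rA'; rewrite rA => /eqP; rewrite eqn_leq ltnn.
by rewrite rA' rA IHB addSn.
Qed.

(** * The code of a representation *)

(** Take all linear dependencies of the vectors: v x lies in the span of A exactly when a dependency
    inside x and A has nonzero coefficient at x. *)
Lemma representation_code (F : fieldType) (E : finType) n (v : E -> 'rV[F]_n) (M : matroid E) :
  represents v M ->
  exists C : pred {ffun E -> F}, lin_code C /\ rank_on C (rk M) (ground M).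
Proof.
move=> rep; exists [pred c : {ffun E -> F} | \sum_x c x *: v x == 0]; split.
  split; first by rewrite inE big1 // => x _; rewrite ffunE scale0r.
  move=> t c d; rewrite !inE => /eqP cC /eqP dC; apply/eqP.
  transitivity (t *: (\sum_x c x *: v x) + \sum_x d x *: v x).
    rewrite scaler_sumr -big_split; apply: eq_bigr => x _ /=.
    by rewrite ffunE scalerDl scalerA.
  by rewrite cC dC scaler0 addr0.
split; first by rewrite rep ?sub0set // big_set0 mxrank0.
move=> A x sA xA; have sA' : A \subset ground M by apply: subset_trans sA; apply: subsetUr.
rewrite !rep // big_setU1 //=; set V := (\sum_(e in A) _)%MS.
have rank_inside : (v x <= V)%MS <-> \rank (<<v x>> + V)%MS = \rank V.
  have [le_rk rkE] := mxrank_leqif_sup (addsmxSr <<v x>>%MS V).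
  have subE : (<<v x>> + V <= V)%MS = (v x <= V)%MS.
    by rewrite addsmx_sub submx_refl andbT genmxE.
  by rewrite -subE -rkE eq_sym; split=> /eqP.
split.
  have rk1 : (\rank <<v x>>%MS <= 1)%N by rewrite genmxE rank_leq_row.
  have le1 := mxrankS (addsmxSr <<v x>>%MS V).
  have [le2 _] := mxrank_adds_leqif <<v x>>%MS V.
  have {}le2 : (\rank (<<v x>> + V)%MS <= (\rank V).+1)%N.
    by apply: leq_trans le2 (leq_add rk1 (leqnn _)).
  move: le2; rewrite leq_eqVlt ltnS => /orP [/eqP|le2]; [by right | left].
  by apply/eqP; rewrite eqn_leq le2.
rewrite -rank_inside; split.
  case/sub_sumsmxP => u vE.
  have [a aE] : exists a : E -> F, forall e, u e *m <<v e>>%MS = a e *: v e.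
    apply: (fin_all_exists (P := fun e t => u e *m <<v e>>%MS = t *: v e)) => e.
    by apply/sub_rVP; apply: submx_trans (submxMl _ _) _; rewrite genmxE.
  (* The expression of v x as a combination of vectors of A, moved to one side. *)
  exists [ffun y => if y == x then -1 else if y \in A then a y else 0]; split.
  - rewrite inE (bigD1 x) //= ffunE eqxx scaleN1r {1}vE addrC subr_eq0; apply/eqP.
    rewrite [RHS]big_mkcond [LHS]big_mkcond; apply: eq_bigr => y _ /=; rewrite ffunE.
    have [->|_] := eqVneq y x; first by rewrite (negPf xA).
    by case: ifP => _; rewrite ?scale0r ?aE.
  - apply/suppP => y; rewrite !inE negb_or ffunE => /andP [/negPf -> /negPf ->] //.
  by rewrite ffunE eqxx oppr_eq0 oner_eq0.
case=> c [cC sc cx]; move: cC; rewrite inE (bigD1 x) //= addr_eq0 => /eqP vE.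
have -> : v x = (c x)^-1 *: (c x *: v x) by rewrite scalerA mulVf // scale1r.
apply: scalemx_sub; rewrite vE eqmx_opp; apply: summx_sub => y yx.
have [->|cy] := eqVneq (c y) 0; first by rewrite scale0r sub0mx.
have yA : y \in A by have := subsetP sc y; rewrite !inE (negPf yx); apply.
by apply: scalemx_sub; apply: (sumsmx_sup y); rewrite ?genmxE.
Qed.

Lemma transport_code (F F0 : fieldType) (E : finType) (C : pred {ffun E -> F})
  (r : {set E} -> nat) X (s : F -> F0) (t : F0 -> F) :
  cancel s t -> cancel t s ->
  {morph t : x y / x + y} -> {morph t : x y / x * y} ->
  lin_code C -> rank_on C r X ->
  exists C0 : pred {ffun E -> F0}, lin_code C0 /\ rank_on C0 r X.
Proof.
move=> sK tK tD tM [C_0 linC] [r0 rS].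
have t0 : t 0 = 0 by apply: (addrI (t 0)); rewrite -tD !addr0.
have teq0 x : (t x == 0) = (x == 0) by rewrite -{1}t0 (inj_eq (can_inj tK)).
exists [pred c : {ffun E -> F0} | [ffun x => t (c x)] \in C]; split.
  split=> [|a c d cC dC].
    rewrite inE; move: C_0; congr (_ \in C); apply/ffunP => x; rewrite !ffunE t0 //.
  rewrite inE; move: (linC (t a) _ _ cC dC); congr (_ \in C); apply/ffunP => x.
  by rewrite !ffunE tD tM.
split=> // A x sA xA; have [rA rA0] := rS A x sA xA; split=> //; rewrite rA0.
have suppE (c : {ffun E -> F0}) : supp [ffun x => t (c x)] = supp c.
  by apply/setP => y; rewrite !inE ffunE teq0.
split=> -[c [cC sc cx]]; last first.
  by exists [ffun x => t (c x)]; rewrite suppE ffunE teq0.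
have cE : [ffun x => t ([ffun x => s (c x)] x)] = c by apply/ffunP => y; rewrite !ffunE sK.
exists [ffun x => s (c x)]; split; first by rewrite inE cE.
  by rewrite -suppE cE.
by rewrite -teq0 ffunE sK.
Qed.

(** * Minimal counterexamples *)

(** Bundles the hypotheses of the theorem, so that sequences of such matroids over varying fields of
    order q can be formed. *)
Record critical (q d : nat) := Critical {
  crit_field : finFieldType;
  crit_elt : finType;
  crit_matroid : matroid crit_elt;
  crit_card : #|crit_field| = q;
  crit_rep : representable crit_field crit_matroid;
  crit_dd : dd crit_matroid = d;
  crit_min : forall S : {set crit_elt}, S \subset ground crit_matroid -> S != set0 ->
    (dd_contract crit_matroid S < d)%N }.

Section FieldTables.
Variables (q d : nat).
Implicit Types w : critical q d.

Definition enc w (x : crit_field w) : 'I_q := cast_ord (crit_card w) (enum_rank x).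
Definition dec w (i : 'I_q) : crit_field w :=
  enum_val (cast_ord (esym (crit_card w)) i).

Lemma encK w : cancel (@enc w) (dec w).
Proof. by move=> x; rewrite /dec /enc cast_ordK enum_rankK. Qed.

Lemma decK w : cancel (dec w) (@enc w).
Proof. by move=> i; rewrite /dec /enc enum_valK cast_ordKV. Qed.

Definition table : finType :=
  ({ffun 'I_q * 'I_q -> 'I_q} * {ffun 'I_q * 'I_q -> 'I_q})%type.

(** Addition and multiplication tables on ['I_q]. They take finitely many values, and equal tables
    make the fields isomorphic through [enc] and [dec]. *)
Definition field_table w : table :=
  ([ffun p => enc (dec w p.1 + dec w p.2)], [ffun p => enc (dec w p.1 * dec w p.2)]).

Lemma critical_code w w0 : field_table w = field_table w0 ->
  exists C : pred {ffun crit_elt w -> crit_field w0},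
    lin_code C /\ rank_on C (rk (crit_matroid w)) (ground (crit_matroid w)).
Proof.
case=> /ffunP eqD /ffunP eqM.
have [n [v rep]] := crit_rep w; have [C [linC rC]] := representation_code rep.
apply: (transport_code (s := dec w0 \o @enc w) (t := dec w \o @enc w0)) linC rC => x /=.
- by rewrite decK encK.
- by rewrite decK encK.
- move=> y; have := eqD (enc x, enc y); rewrite !ffunE /= !encK => <-.
  by rewrite encK.
move=> y; have := eqM (enc x, enc y); rewrite !ffunE /= !encK => <-.
by rewrite encK.
Qed.

Lemma critical_bounded : exists N, forall w, (#|ground (crit_matroid w)| <= N)%N.
Proof.
apply: NNPP => unbounded.
have big N : exists w, (N < #|ground (crit_matroid w)|)%N.
  apply: NNPP => no; apply: unbounded; exists N => w; rewrite leqNgt.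
  by apply/negP => lt; apply: no; exists w.
pose t N := proj1_sig (constructive_indefinite_description _ (big N)).
have tP N : (N < #|ground (crit_matroid (t N))|)%N.
  exact: proj2_sig (constructive_indefinite_description _ (big N)).
(* Each term has more elements than the one before. *)
pose s n := iter n (fun w => t #|ground (crit_matroid w)|) (t 0%N).
pose size n := #|ground (crit_matroid (s n))|.
have size_mono i j : (i < j)%N -> (size i < size j)%N.
  by apply: iter_increasing => n; apply: tP.
have size_gt0 n : (0 < size n)%N by case: n => [|n]; apply: leq_ltn_trans (leq0n _) (tP _).
have eq_tr (x y z : table) : x = y -> y = z -> x = z by move=> ->.
have [h [hmono hcol]] :=
  wqo_subseq (s := field_table \o s) eq_tr (@wqo_finite _) (fun=> I).
pose w0 := s (h 0%N).
have tab n : field_table (s (h n)) = field_table w0.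
  by case: n => // n; apply/esym/(hcol 0%N n.+1).
have ptP n : exists x, x \in ground (crit_matroid (s n)).
  by apply/set0Pn; rewrite -card_gt0; apply: size_gt0.
pose pt n := proj1_sig (constructive_indefinite_description _ (ptP n)).
pose C n := proj1_sig (constructive_indefinite_description _ (critical_code (tab n))).
have CP n := proj2_sig (constructive_indefinite_description _ (critical_code (tab n))).
(* On a subsequence with constant table all codes move to the one field of [w0]; the initial labels
   are trivial. *)
pose p n : piece (crit_field w0) unit :=
  Piece (pt (h n)) (C n) (rk (crit_matroid (s (h n)))) (ground (crit_matroid (s (h n)))) (fun=> tt).
have [n|i [j [ltij [f emb]]]] := @wqo_pieces (crit_field w0) d unit p.
  have [lin rkC] := CP n; split=> //; exists #|ground (crit_matroid (s (h n)))|; split=> //.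
  by have /eq_leq := crit_dd (s (h n)).
have [_ rki] := CP i; have [_ rkj] := CP j.
have crk := contract_rank rki rkj emb; have [inj im _ _] := emb.
rewrite /= in inj im crk.
set G := ground (crit_matroid (s (h i))) in inj im crk.
set G' := ground (crit_matroid (s (h j))) in im crk.
set S := G' :\: f @: G in crk.
have sfG : f @: G \subset G' by apply/subsetP => _ /imsetP [x /im [fG _] ->].
have G'S : G' :\: S = f @: G by rewrite setDDr setDv set0U; apply/setIidPr.
have cardfG : #|f @: G| = #|G| by apply: card_in_imset.
have S0 : S != set0.
  rewrite -card_gt0 cardsD (setIidPr sfG) cardfG subn_gt0.
  exact: size_mono (hmono _ _ ltij).
(* The contraction by S is isomorphic to the smaller matroid, whose depth is d, while criticality
   demands depth below d. *)
have := crit_min (subsetDl G' (f @: G)) S0.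
rewrite /dd_contract /dd_of -/G' -/S G'S cardfG (ddf_iso (r := rk (crit_matroid (s (h i))))) //.
by have := crit_dd (s (h i)); rewrite /dd /dd_of => ->; rewrite ltnn.
Qed.

End FieldTables.

Local Close Scope ring_scope.

Theorem theorem5 :
  exists f : nat -> nat -> nat,
    forall (F : finFieldType) (E : finType) (M : matroid E) (d : nat),
      representable F M ->
      dd M = d ->
      (forall S : {set E}, S \subset ground M -> S != set0 ->
         dd_contract M S < d) ->
      #|ground M| <= f #|F| d.
Proof.
exists (fun q d => proj1_sig (constructive_indefinite_description _ (critical_bounded q d))).
move=> F E M d rep ddM minM.
exact: (proj2_sig (constructive_indefinite_description _ (critical_bounded #|F| d))
  (Critical (erefl #|F|) rep ddM minM)).
Qed.
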